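(* Let $n\geq 1$ be an integer, let $\phi\in L^\infty(\mathbb{T})$ have Fourier series $\phi(z)=\sum_{k=-\infty}^{\infty}\hat{\phi}(k)z^k$, and let $T_\phi$ be the Toeplitz operator on $H^2_{\mathbb{C}}(\mathbb{D})$ with symbol $\phi$. Let $C_n$ be the conjugation on $H^2_{\mathbb{C}}(\mathbb{D})$ defined by $$C_n\Big(\sum_{k=0}^{\infty}\sum_{m=0}^{n-1}a_{nk+m}z^{nk+m}\Big)=\sum_{k=0}^{\infty}\sum_{m=0}^{n-1}\overline{a_{nk+(n-m-1)}}\,z^{nk+m}.$$ Then $T_\phi$ is complex symmetric with respect to $C_n$ if and only if $\hat{\phi}(nl)=\hat{\phi}(-nl)$ and $\hat{\phi}(r+nl)=0$ for all $l\in\mathbb{Z}$ and all integers $r$ with $1\leq r\leq n-1$.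
   Context: $\mathbb{D}$ is the open unit disc and $\mathbb{T}$ the unit circle in $\mathbb{C}$. $H^2_{\mathbb{C}}(\mathbb{D})$ is the Hardy space of power series $f(z)=\sum_{n\ge0}a_nz^n$ with $a_n\in\mathbb{C}$ and $\|f\|^2=\sum_{n\ge 0}|a_n|^2<\infty$, identified with the closed subspace of $L^2(\mathbb{T})$ (normalized Lebesgue measure) of functions whose negative Fourier coefficients vanish; $P$ is the orthogonal projection of $L^2(\mathbb{T})$ onto it. For $\phi\in L^\infty(\mathbb{T})$, $\hat\phi(k)$ ($k\in\mathbb{Z}$) is the $k$-th Fourier coefficient of $\phi$, and $T_\phi f=P(\phi f)$ for $f\in H^2_{\mathbb{C}}(\mathbb{D})$. A conjugation on a complex Hilbert space $\mathcal{H}$ is a map $C:\mathcal{H}\to\mathcal{H}$ that is conjugate linear, isometric ($\|Cx\|=\|x\|$) and satisfies $C^2=I$. A bounded operator $T$ on $\mathcal{H}$ is complex symmetric with respect to $C$ if $CTC=T^*$. *)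

(* Defs.v *)
From HB Require Import structures.
From mathcomp Require Import all_boot all_order all_algebra.
From mathcomp Require Import complex.
From mathcomp Require Import all_classical all_reals all_analysis.
From mathcomp Require Import zify ring.

Set Implicit Arguments.
Unset Strict Implicit.
Unset Printing Implicit Defensive.

Import Order.TTheory GRing.Theory Num.Theory.
Import numFieldNormedType.Exports.

Local Open Scope classical_set_scope.
Local Open Scope ring_scope.

(* |z|^2, as an element of R rather than of R[i] *)
Definition sqnormc (R : realType) (z : R[i]) : R :=
  complex.Re z ^+ 2 + complex.Im z ^+ 2.

Section sqnormc.
Context {R : realType}.
Implicit Types z w : R[i].

Lemma sqnormc_ge0 z : 0 <= sqnormc z.
Proof. by rewrite /sqnormc addr_ge0 ?sqr_ge0. Qed.

Lemma sqnormcJ z : sqnormc (conjc z) = sqnormc z.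
Proof. by case: z => a b; rewrite /sqnormc /= sqrrN. Qed.

Lemma sqnormcM z w : sqnormc (z * w) = sqnormc z * sqnormc w.
Proof. by case: z w => a b [c d]; rewrite /sqnormc /=; ring. Qed.

Lemma sqnormcD_le z w : sqnormc (z + w) <= 2 * sqnormc z + 2 * sqnormc w.
Proof.
case: z w => a b [c d]; rewrite /sqnormc /= -subr_ge0.
rewrite [leRHS](_ : _ = (a - c) ^+ 2 + (b - d) ^+ 2); last by ring.
by rewrite addr_ge0 ?sqr_ge0.
Qed.

End sqnormc.

Definition sqsum (R : realType) (a : nat -> R[i]) : \bar R :=
  (\sum_(0 <= k <oo) (sqnormc (a k))%:E)%E.

Definition square_summable (R : realType) : {pred (nat -> R[i])} :=
  [pred a | (sqsum a < +oo)%E].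

(* a power series in H^2(D) is given by its sequence of coefficients *)
Record hardy (R : realType) := Hardy {
  coef :> nat -> R[i];
  coef_square_summable : coef \in @square_summable R }.

Section hardy_lmod.
Context (R : realType).

Lemma square_summable_submod : submod_closed (@square_summable R).
Proof.
split=> [|c a b].
  rewrite inE /sqsum eseries0 ?ltry// => k _ _.
  by rewrite /sqnormc /= expr0n /= addr0.
rewrite !inE => fa fb.
pose M k := ((2 * sqnormc c)%:E * (sqnormc (a k))%:E
  + 2%:E * (sqnormc (b k))%:E)%E.
apply: (@le_lt_trans _ _ (\sum_(0 <= k <oo) M k)%E).
  apply: lee_nneseries => [k _ _|k _]; first by rewrite lee_fin sqnormc_ge0.
  rewrite /M -!EFinM -EFinD lee_fin -mulrA -sqnormcM.
  exact: sqnormcD_le.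
rewrite nneseriesD; last 2 first.
- by move=> k _ _; rewrite -EFinM lee_fin !mulr_ge0 ?sqnormc_ge0.
- by move=> k _ _; rewrite -EFinM lee_fin mulr_ge0 ?sqnormc_ge0.
rewrite !nneseriesZl.
- by apply: lte_add_pinfty; apply: lte_mul_pinfty;
    rewrite ?lee_fin ?mulr_ge0 ?sqnormc_ge0.
- by move=> k _; rewrite lee_fin sqnormc_ge0.
- by move=> k _; rewrite lee_fin sqnormc_ge0.
Qed.

HB.instance Definition _ :=
  GRing.isSubmodClosed.Build R[i] (nat -> R[i]) (@square_summable R)
    square_summable_submod.
HB.instance Definition _ := [isSub for @coef R].
HB.instance Definition _ := [Choice of hardy R by <:].
HB.instance Definition _ := [SubChoice_isSubLmodule of hardy R by <:].

End hardy_lmod.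

Definition hnorm (R : realType) (f : hardy R) : R :=
  Num.sqrt (fine (sqsum f)).

(* sum of a complex series, computed on real and imaginary parts *)
Definition cseries (R : realType) (u : nat -> R[i]) : R[i] :=
  Complex (limn (series (fun k => complex.Re (u k))))
          (limn (series (fun k => complex.Im (u k)))).

Definition hdot (R : realType) (f g : hardy R) : R[i] :=
  cseries (fun k => f k * conjc (g k)).

Record conjugation (R : realType) := Conjugation {
  conj_fun :> hardy R -> hardy R;
  conj_antilinear : forall (c : R[i]) (f g : hardy R),
    conj_fun (c *: f + g) = conjc c *: conj_fun f + conj_fun g;
  conj_isometry : forall f, hnorm (conj_fun f) = hnorm f;
  conj_involutive : forall f, conj_fun (conj_fun f) = f }.

Definition is_adjoint (R : realType) (T S : hardy R -> hardy R) : Prop :=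
  forall f g, hdot (T f) g = hdot f (S g).

(* C T C = T^*; a map with an adjoint in this sense is automatically linear,
   and bounded by the Hellinger-Toeplitz theorem. *)
Definition complex_symmetric (R : realType) (C : conjugation R)
    (T : hardy R -> hardy R) : Prop :=
  is_adjoint T (fun f => C (T (C f))).

(* flip n exchanges the exponents nk+m and nk+(n-m-1) for 0 <= m < n *)
Definition flip (n j : nat) : nat := (n * (j %/ n) + (n - j %% n - 1))%N.

Lemma flipE n k m : (m < n)%N -> flip n (n * k + m) = (n * k + (n - m - 1))%N.
Proof.
move=> mn; have n0 : (0 < n)%N by exact: leq_ltn_trans mn.
rewrite /flip [(n * k)%N]mulnC divnMDl// divn_small// addn0 modnMDl.
by rewrite modn_small// mulnC.
Qed.

Lemma flipK n : (1 <= n)%N -> involutive (flip n).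
Proof.
move=> n0 j; have jn : (j %% n < n)%N by rewrite ltn_mod.
rewrite {2}/flip flipE; last by lia.
by rewrite [RHS](divn_eq j n); lia.
Qed.

Section Cn.
Context (R : realType) (n : nat) (n1 : (1 <= n)%N).

Definition Cn_coef (a : nat -> R[i]) : nat -> R[i] :=
  fun j => conjc (a (flip n j)).

Lemma sqsum_Cn_coef a : sqsum (Cn_coef a) = sqsum a.
Proof.
have nn (b : nat -> R[i]) k : (0 <= (sqnormc (b k))%:E)%E.
  by rewrite lee_fin sqnormc_ge0.
rewrite /sqsum !nneseries_esumT//.
rewrite [RHS](reindex_esum [set: nat] [set: nat] (flip n))//; last first.
  by rewrite setTT_bijective; exact: inv_bij (flipK n1).
by apply: eq_esum => k _; rewrite /Cn_coef sqnormcJ.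
Qed.

Lemma Cn_square_summable (f : hardy R) : Cn_coef f \in @square_summable R.
Proof. by rewrite inE sqsum_Cn_coef; exact: coef_square_summable. Qed.

Definition Cn_fun (f : hardy R) : hardy R := Hardy (Cn_square_summable f).

Lemma Cn_antilinear (c : R[i]) (f g : hardy R) :
  Cn_fun (c *: f + g) = conjc c *: Cn_fun f + Cn_fun g.
Proof.
apply/val_inj/funext => j /=.
rewrite /Cn_coef -[LHS]/(conjc (c * f (flip n j) + g (flip n j))).
by rewrite rmorphD rmorphM.
Qed.

Lemma Cn_isometry f : hnorm (Cn_fun f) = hnorm f.
Proof. by rewrite /hnorm sqsum_Cn_coef. Qed.

Lemma Cn_involutive f : Cn_fun (Cn_fun f) = f.
Proof. by apply/val_inj/funext => j /=; rewrite /Cn_coef flipK// conjcK. Qed.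

Definition Cn : conjugation R :=
  Conjugation Cn_antilinear Cn_isometry Cn_involutive.

End Cn.

Lemma CnE (R : realType) (n : nat) (n1 : (1 <= n)%N) (f : hardy R) (k m : nat) :
  (m < n)%N -> Cn R n1 f (n * k + m)%N = conjc (f (n * k + (n - m - 1))%N).
Proof. by move=> mn; rewrite /= /Cn_coef flipE. Qed.

Lemma twopi_gt0 (R : realType) : 0 < 2 * pi :> R.
Proof. by rewrite mulr_gt0// pi_gt0. Qed.

(* A function on the unit circle is given by its values at e^{it}, as a function
   of the real variable t. The circle carries the normalized Lebesgue measure
   dt / (2 pi) on [0, 2 pi]; since it vanishes outside this interval, the values
   for other t are irrelevant. *)
Definition circle_measure (R : realType) : probability (measurableTypeR R) R :=
  uniform_prob (twopi_gt0 R).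

Definition expi (R : realType) (t : R) : R[i] := Complex (cos t) (sin t).

(* a complex function is in L^p iff its real and imaginary parts are *)
Definition LT (R : realType) (p : \bar R) : set (R -> R[i]) :=
  [set f | (fun t => complex.Re (f t)) \in Lfun (circle_measure R) p /\
           (fun t => complex.Im (f t)) \in Lfun (circle_measure R) p].

Definition intT (R : realType) (f : R -> R[i]) : R[i] :=
  Complex (\int[circle_measure R]_t complex.Re (f t))
          (\int[circle_measure R]_t complex.Im (f t)).

Definition dotT (R : realType) (f g : R -> R[i]) : R[i] :=
  intT (fun t => f t * conjc (g t)).

Definition fourier (R : realType) (f : R -> R[i]) (k : int) : R[i] :=
  intT (fun t => f t * expi t ^ (- k)).

Definition sqnormT (R : realType) (f : R -> R[i]) : \bar R :=
  (\int[circle_measure R]_t (sqnormc (f t))%:E)%E.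

(* H^2 as a subspace of L^2 of the circle *)
Definition hardyT (R : realType) : set (R -> R[i]) :=
  [set f | LT 2%:E f /\ forall k : int, k < 0 -> fourier f k = 0].

(* the element of L^2 identified with the power series f, namely the sum in L^2
   of the series with terms (f k) e^{ikt} (well-defined almost everywhere) *)
Definition boundary (R : realType) (f : hardy R) : R -> R[i] :=
  xget (fun=> 0) [set F | LT 2%:E F /\
    sqnormT (fun t => F t - \sum_(k < N) f k * expi t ^+ k) @[N --> \oo]
      --> 0%E].

(* orthogonal projection of L^2 onto hardyT (well-defined almost everywhere) *)
Definition proj_hardyT (R : realType) (g : R -> R[i]) : R -> R[i] :=
  xget (fun=> 0) [set h | @hardyT R h /\
    forall u, @hardyT R u -> dotT (fun t => g t - h t) u = 0].

(* the power series identified with an element of hardyT *)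
Definition power_series (R : realType) (h : R -> R[i]) : hardy R :=
  xget 0 [set f : hardy R | forall k : nat, f k = fourier h k%:Z].

Definition toeplitz (R : realType) (phi : R -> R[i]) (f : hardy R) : hardy R :=
  power_series (proj_hardyT (fun t => phi t * boundary f t)).

(* Main.v *)
From HB Require Import structures.
Require Import Defs.
From mathcomp Require Import all_boot all_order all_algebra.
From mathcomp Require Import complex.
From mathcomp Require Import all_classical all_reals all_analysis.
From mathcomp Require Import measurable_realfun ess_sup_inf zify ring lra.

(** Let [e_k] be the exponential of frequency [k] on the circle. The entry of
    [T_phi] at [(i, j)] is [<phi e_j, e_i> = phi^(i - j)], and [C_n] maps [e_i]
    to [e_(flip i)], where [flip] reverses each block of [n] consecutive
    indices. Hence [C_n T_phi C_n = T_phi^*] amounts to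
    [phi^(i - j) = phi^(flip j - flip i)] for all [i, j >= 0]
    ([complex_symmetric_flip]).

    Write [i = n k + m] and [j = n k' + m'] with [0 <= m, m' < n]. The identity
    becomes [phi^(s + n l) = phi^(s - n l)] for all [l] and all [|s| < n]. For
    [s = 0] this is the first condition of the theorem. For [0 < r < n], it
    holds with [s = r] and with [s = r - n], which reflects the progression
    [r + n Z] in two points at distance [n]; the coefficients along this
    progression therefore have period [2 n]. They tend to zero by Bessel's
    inequality ([bessel_ccvg0]), so they all vanish
    ([fourier_progression_eq0], [flip_symmetricP]).

    The rest establishes that the matrix describes the operator. Boundary
    functions and projections are chosen from sets of functions that have to be
    inhabited, which rests on the completeness of [L^2] ([L2_complete]): a
    sequence that is Cauchy at a geometric rate converges almost everywhere,
    and Fatou's lemma gives convergence in norm. Completeness yields boundary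
    functions by the Riesz-Fischer theorem ([orthonormal_series_vcvg]) and the
    projection onto the closed subspace [H^2] by minimizing the distance
    ([projection]); both are proved for abstract semi-inner products. It
    follows that [<T_phi f, g>] is the integral of [phi F conj(G)], where [F]
    and [G] are the boundary functions of [f] and [g] ([hdot_toeplitz]). This
    expression is continuous in [F] and in [G], so that identities between
    matrix entries extend to all [f] and [g]. *)

Set Implicit Arguments.
Unset Strict Implicit.
Unset Printing Implicit Defensive.

Import Order.TTheory GRing.Theory Num.Theory.
Import numFieldNormedType.Exports.

Local Open Scope classical_set_scope.
Local Open Scope ring_scope.

Local Notation Re := complex.Re.
Local Notation Im := complex.Im.

(** * Convergence of complex sequences *)

Lemma squeeze0 {R : realType} (u v : nat -> R) :
  (forall N, 0 <= u N <= v N) -> v @ \oo --> 0 -> u @ \oo --> 0.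
Proof.
move=> uv v0; apply: (@squeeze_cvgr _ _ _ _ (fun=> 0) v) => //.
- exact: nearW.
- exact: cvg_cst.
Qed.

Section complex_convergence.
Context {R : realType}.
Implicit Types (z w : R[i]) (u : nat -> R[i]).

Lemma ReD z w : Re (z + w) = Re z + Re w. Proof. by case: z w => ? ? []. Qed.
Lemma ImD z w : Im (z + w) = Im z + Im w. Proof. by case: z w => ? ? []. Qed.
Lemma ReN z : Re (- z) = - Re z. Proof. by case: z. Qed.
Lemma ImN z : Im (- z) = - Im z. Proof. by case: z. Qed.
Lemma ReM z w : Re (z * w) = Re z * Re w - Im z * Im w.
Proof. by case: z w => ? ? []. Qed.
Lemma ImM z w : Im (z * w) = Re z * Im w + Im z * Re w.
Proof. by case: z w => ? ? [] /= *; rewrite addrC. Qed.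
Lemma ReJ z : Re (conjc z) = Re z. Proof. by case: z. Qed.
Lemma ImJ z : Im (conjc z) = - Im z. Proof. by case: z. Qed.

Definition ReImE := (ReD, ImD, ReN, ImN, ReM, ImM, ReJ, ImJ).

Lemma complex_ext z w : Re z = Re w -> Im z = Im w -> z = w.
Proof. by case: z w => ? ? [? ?] /= -> ->. Qed.

Lemma Re_sum (I : Type) (s : seq I) (F : I -> R[i]) :
  Re (\sum_(i <- s) F i) = \sum_(i <- s) Re (F i).
Proof. by apply: (big_morph (@complex.Re R)); [exact: ReD|]. Qed.

Lemma Im_sum (I : Type) (s : seq I) (F : I -> R[i]) :
  Im (\sum_(i <- s) F i) = \sum_(i <- s) Im (F i).
Proof. by apply: (big_morph (@complex.Im R)); [exact: ImD|]. Qed.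

Lemma sqnormcE z : z * conjc z = (sqnormc z)%:C%C.
Proof. by case: z => a b; apply: complex_ext; rewrite /sqnormc /=; ring. Qed.

(** Measured by the real number [|u N - z|^2], which the Cauchy-Schwarz
    inequality bounds without square roots. *)
Definition ccvg u z := sqnormc (u N - z) @[N --> \oo] --> (0 : R).

Lemma ccvg_Re u z : ccvg u z -> Re (u N) @[N --> \oo] --> Re z.
Proof.
move=> uz; apply/cvgrPdist_lt => e e0.
move/cvgrPdist_lt: uz => /(_ (e ^+ 2)); rewrite exprn_gt0// => /(_ isT).
apply: filterS => N; rewrite sub0r normrN ger0_norm ?sqnormc_ge0// => h.
rewrite -(@ltr_pXn2r _ 2) ?nnegrE ?(ltW e0)//; apply: le_lt_trans h.
by rewrite real_normK ?num_real// /sqnormc -sqrrN opprB !ReImE lerDl sqr_ge0.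
Qed.

Lemma ccvg_Im u z : ccvg u z -> Im (u N) @[N --> \oo] --> Im z.
Proof.
move=> uz; apply/cvgrPdist_lt => e e0.
move/cvgrPdist_lt: uz => /(_ (e ^+ 2)); rewrite exprn_gt0// => /(_ isT).
apply: filterS => N; rewrite sub0r normrN ger0_norm ?sqnormc_ge0// => h.
rewrite -(@ltr_pXn2r _ 2) ?nnegrE ?(ltW e0)//; apply: le_lt_trans h.
by rewrite real_normK ?num_real// /sqnormc -sqrrN opprB !ReImE lerDr sqr_ge0.
Qed.

Lemma ccvg_unique u z w : ccvg u z -> ccvg u w -> z = w.
Proof.
move=> uz uw; apply: complex_ext.
  by apply: (cvg_unique _ (ccvg_Re uz) (ccvg_Re uw)).
by apply: (cvg_unique _ (ccvg_Im uz) (ccvg_Im uw)).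
Qed.

Lemma ccvg_cst z : ccvg (fun=> z) z.
Proof.
apply: (@squeeze0 _ _ (fun=> 0)); last exact: cvg_cst.
by move=> N; rewrite subrr /sqnormc /= expr0n addr0 lexx.
Qed.

Lemma ccvg_near u v z :
  (\forall N \near \oo, u N = v N) -> ccvg u z -> ccvg v z.
Proof.
move=> uv; apply: cvg_trans; apply: near_eq_cvg.
by apply: filterS uv => N ->.
Qed.

Lemma ccvg_comp u z (f : nat -> nat) :
  f @ \oo --> \oo -> ccvg u z -> ccvg (u \o f) z.
Proof. by move=> fo uz; apply: (cvg_comp f _ fo uz). Qed.

Lemma cseries_ccvg u z : ccvg (fun N => \sum_(k < N) u k) z -> cseries u = z.
Proof.
move=> uz; apply: complex_ext => /=; apply: cvg_lim => //.
  apply: cvg_trans (ccvg_Re uz); apply: near_eq_cvg; apply: nearW => N.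
  by rewrite seriesEord/= Re_sum.
apply: cvg_trans (ccvg_Im uz); apply: near_eq_cvg; apply: nearW => N.
by rewrite seriesEord/= Im_sum.
Qed.

End complex_convergence.

(** * Semi-inner product spaces *)

(** Only semi-definite: in the space [L2] below, functions that agree almost
    everywhere remain distinct vectors. *)
Record semi_inner (R : realType) (V : lmodType R[i]) := SemiInner {
  inner :> V -> V -> R[i];
  ipDZl : forall c f g h, inner (c *: f + g) h = c * inner f h + inner g h;
  ipC : forall f g, inner f g = conjc (inner g f);
  ip_ge0 : forall f, 0 <= Re (inner f f) }.

Section semi_inner_theory.
Context {R : realType} {V : lmodType R[i]} (ip : semi_inner V).
Implicit Types (f g h : V) (u : nat -> V) (M : V -> Prop).

Definition sqn f : R := Re (ip f f).

Lemma sqn_ge0 f : 0 <= sqn f. Proof. exact: ip_ge0. Qed.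

Lemma ipDl f g h : ip (f + g) h = ip f h + ip g h.
Proof. by rewrite -{1}[f]scale1r ipDZl mul1r. Qed.
Lemma ip0l h : ip 0 h = 0.
Proof. by apply: (addrI (ip 0 h)); rewrite -ipDl !addr0. Qed.
Lemma ipZl c f h : ip (c *: f) h = c * ip f h.
Proof. by rewrite -{1}[c *: f]addr0 ipDZl ip0l addr0. Qed.
Lemma ipNl f h : ip (- f) h = - ip f h.
Proof. by rewrite -scaleN1r ipZl mulN1r. Qed.
Lemma ipBl f g h : ip (f - g) h = ip f h - ip g h.
Proof. by rewrite ipDl ipNl. Qed.
Lemma ipDr f g h : ip h (f + g) = ip h f + ip h g.
Proof. by rewrite (ipC ip h f) (ipC ip h g) [LHS]ipC ipDl rmorphD. Qed.
Lemma ipZr c f h : ip h (c *: f) = conjc c * ip h f.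
Proof. by rewrite (ipC ip h f) [LHS]ipC ipZl rmorphM. Qed.
Lemma ipNr f h : ip h (- f) = - ip h f.
Proof. by rewrite (ipC ip h f) [LHS]ipC ipNl rmorphN. Qed.
Lemma ipBr f g h : ip h (f - g) = ip h f - ip h g.
Proof. by rewrite ipDr ipNr. Qed.

Lemma ip_suml (I : Type) (s : seq I) (F : I -> V) h :
  ip (\sum_(i <- s) F i) h = \sum_(i <- s) ip (F i) h.
Proof.
by apply: (big_morph (ip^~ h)); [move=> ? ?; exact: ipDl|exact: ip0l].
Qed.

Lemma ip_sumr (I : Type) (s : seq I) (F : I -> V) h :
  ip h (\sum_(i <- s) F i) = \sum_(i <- s) ip h (F i).
Proof.
apply: (big_morph (ip h)); first by move=> ? ?; exact: ipDr.
by rewrite ipC ip0l rmorph0.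
Qed.

Lemma ip_sqn f : ip f f = (sqn f)%:C%C.
Proof.
apply: complex_ext => //=; have := congr1 (@complex.Im R) (ipC ip f f).
by rewrite ImJ; lra.
Qed.

Lemma sqnZ c f : sqn (c *: f) = sqnormc c * sqn f.
Proof.
by rewrite /sqn ipZl ipZr mulrA sqnormcE ip_sqn -rmorphM.
Qed.

Lemma sqnN f : sqn (- f) = sqn f.
Proof. by rewrite /sqn ipNl ipNr opprK. Qed.

Lemma sqnD f g : sqn (f + g) = sqn f + sqn g + 2 * Re (ip f g).
Proof.
rewrite /sqn !ipDl !ipDr !ReD (ipC ip g f) ReJ; ring.
Qed.

Lemma parallelogram f g : sqn (f + g) + sqn (f - g) = 2 * sqn f + 2 * sqn g.
Proof. by rewrite !sqnD sqnN ipNr ReN; ring. Qed.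

Lemma sqnD_le f g : sqn (f + g) <= 2 * sqn f + 2 * sqn g.
Proof. by rewrite -parallelogram lerDl sqn_ge0. Qed.

Lemma sqnB_le f g h : sqn (f - g) <= 2 * sqn (f - h) + 2 * sqn (h - g).
Proof. by rewrite -[f - g](subrKA h) sqnD_le. Qed.

(** Expanding the square of [f - s c g], where [c = <f, g>]: a nonnegative
    quadratic polynomial in the real parameter [s]. *)
Lemma sqn_sub_proj f g (s : R) :
  sqn (f - ((s%:C)%C * ip f g) *: g) =
  sqn f - 2 * s * sqnormc (ip f g) + s ^+ 2 * sqnormc (ip f g) * sqn g.
Proof.
rewrite sqnD sqnN sqnZ ipNr ipZr rmorphM sqnormcM.
set z := ip f g; case: z => a b; rewrite /sqnormc /=.
by ring.
Qed.

(** The quadratic polynomial of [sqn_sub_proj] is evaluated at its minimum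
    [1 / sqn g]; when [sqn g = 0] it is affine in [s], so its slope vanishes. *)
Lemma cauchy_schwarz f g : sqnormc (ip f g) <= sqn f * sqn g.
Proof.
set s := sqnormc _; have s0 : 0 <= s by exact: sqnormc_ge0.
have key t : 0 <= sqn f - 2 * t * s + t ^+ 2 * s * sqn g.
  by rewrite -sqn_sub_proj sqn_ge0.
have [g0|g0] := eqVneq (sqn g) 0.
  rewrite g0 mulr0; rewrite leNgt; apply/negP => sp.
  have := key (sqn f / s); rewrite g0 mulr0 addr0.
  have := key ((sqn f + 1) / s); rewrite g0 mulr0 addr0.
  rewrite -!mulrA !mulVf ?gt_eqF//; have := sqn_ge0 f; lra.
have gp : 0 < sqn g by rewrite lt_neqAle eq_sym g0 sqn_ge0.
have := key (sqn g)^-1.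
rewrite (_ : _ + _ = sqn f - s / sqn g).
  by rewrite subr_ge0 ler_pdivrMr.
by field.
Qed.

Definition vcvg u f := sqn (u N - f) @[N --> \oo] --> (0 : R).

Lemma vcvg_ipl u f g : vcvg u f -> ccvg (fun N => ip (u N) g) (ip f g).
Proof.
move=> uf; apply: (@squeeze0 _ _ (fun N => sqn (u N - f) * sqn g)).
  by move=> N; rewrite sqnormc_ge0 -ipBl cauchy_schwarz.
by rewrite -(mul0r (sqn g)); apply: cvgMl.
Qed.

Lemma vcvg_ipr u f g : vcvg u f -> ccvg (fun N => ip g (u N)) (ip g f).
Proof.
move=> uf; apply: (@squeeze0 _ _ (fun N => sqn g * sqn (u N - f))).
  by move=> N; rewrite sqnormc_ge0 -ipBr cauchy_schwarz.
by rewrite -(mulr0 (sqn g)); apply: cvgMr.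
Qed.

Section orthonormal.
Context (e : nat -> V) (eo : forall i j, ip (e i) (e j) = (i == j)%:R).

Lemma sqn_orthonormal_sum (a : nat -> R[i]) m N : (m <= N)%N ->
  sqn (\sum_(m <= k < N) a k *: e k) = \sum_(m <= k < N) sqnormc (a k).
Proof.
move=> mN; rewrite -(subnKC mN); elim: (N - m)%N => [|n IH].
  by rewrite addn0 !big_geq// /sqn ip0l.
rewrite addnS !big_nat_recr/= ?leq_addr// sqnD IH sqnZ ipZr ip_suml.
have -> : \sum_(m <= k < m + n) ip (a k *: e k) (e (m + n)%N) = 0.
  rewrite big_nat big1// => k /andP[_ kn].
  by rewrite ipZl eo ltn_eqF// mulr0.
by rewrite mulr0 mulr0 addr0 /sqn eo eqxx /= mulr1.
Qed.

(** The difference of [f] and its projection on the span of the first [N]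
    vectors has nonnegative square. *)
Lemma bessel f N : \sum_(k < N) sqnormc (ip f (e k)) <= sqn f.
Proof.
pose S := \sum_(k < N) ip f (e k) *: e k.
have fS : Re (ip f S) = \sum_(k < N) sqnormc (ip f (e k)).
  rewrite ip_sumr Re_sum; apply: eq_bigr => k _.
  by rewrite ipZr mulrC sqnormcE.
have SS : sqn S = \sum_(k < N) sqnormc (ip f (e k)).
  have := @sqn_orthonormal_sum (fun k => ip f (e k)) 0 N (leq0n N).
  by rewrite !big_mkord.
have := sqn_ge0 (f - S); rewrite sqnD sqnN ipNr ReN fS SS; lra.
Qed.

(** Riemann-Lebesgue: the terms of a convergent series tend to zero. *)
Lemma bessel_ccvg0 f : ccvg (fun k => ip f (e k)) 0.
Proof.
rewrite /ccvg; under eq_fun do rewrite subr0.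
apply: cvg_series_cvg_0; apply: nondecreasing_is_cvgn.
  by apply: nondecreasing_series => k _ _; exact: sqnormc_ge0.
by exists (sqn f) => _ [N _ <-]; rewrite seriesEord; exact: bessel.
Qed.

Lemma bessel_square_summable f :
  (fun k => ip f (e k)) \in @square_summable R.
Proof.
rewrite inE; apply: (@le_lt_trans _ _ (sqn f)%:E); last exact: ltry.
apply: lime_le.
  by apply: is_cvg_nneseries => k _ _; rewrite lee_fin sqnormc_ge0.
by apply: nearW => N; rewrite sumEFin lee_fin big_mkord; exact: bessel.
Qed.

End orthonormal.

(** Completeness is asked of sequences that are Cauchy at a geometric rate,
    because in [L^2] these converge almost everywhere without extraction of a
    subsequence; [cauchy_vcvg] extends it to all Cauchy sequences. *)
Definition complete_semi_inner := forall u,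
  (forall k m, (k <= m)%N -> sqn (u k - u m) <= 4^-1 ^+ k) ->
  exists f, vcvg u f.

Lemma geometric4_cvg0 : 4^-1 ^+ k @[k --> \oo] --> (0 : R).
Proof. by apply: cvg_expr; rewrite ger0_norm; lra. Qed.

Section complete.
Context (Vc : complete_semi_inner).

Lemma cauchy_vcvg u :
  (forall eps, 0 < eps -> exists N, forall i j, (N <= i)%N -> (N <= j)%N ->
    sqn (u i - u j) <= eps) ->
  exists f, vcvg u f.
Proof.
move=> uC.
have /choice[N NP] : forall k, exists N, forall i j, (N <= i)%N -> (N <= j)%N ->
    sqn (u i - u j) <= 4^-1 ^+ k / 4.
  by move=> k; apply: uC; rewrite divr_gt0// exprn_gt0//; lra.
(* The indices N k may fail to increase: two terms are compared through a
   common later index. *)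
have [k m km|f fP] := Vc (u := u \o N).
  have le4 : 4^-1 ^+ m <= 4^-1 ^+ k :> R by rewrite ler_wiXn2l//; lra.
  have h1 := NP k (N k) (maxn (N k) (N m)) (leqnn _) (leq_maxl _ _).
  have h2 := NP m (maxn (N k) (N m)) (N m) (leq_maxr _ _) (leqnn _).
  apply: (le_trans (sqnB_le _ _ (u (maxn (N k) (N m))))) => /=.
  lra.
exists f; apply/cvgrPdist_le => eps eps0.
have e4 : 0 < eps / 4 by lra.
move/cvgrPdist_le: fP => /(_ _ e4) fP.
have /cvgrPdist_le/(_ _ e4) gP := geometric4_cvg0.
have [k [fk gk]] : exists k,
    sqn (u (N k) - f) <= eps / 4 /\ 4^-1 ^+ k <= eps / 4 :> R.
  have [k _ /(_ k (leqnn _)) [h1 h2]] := filterI fP gP; exists k.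
  split.
    by move: h1; rewrite sub0r normrN ger0_norm ?sqn_ge0.
  by move: h2; rewrite sub0r normrN ger0_norm// exprn_ge0//; lra.
exists (N k) => // i Ni /=.
rewrite sub0r normrN ger0_norm ?sqn_ge0//.
apply: (le_trans (sqnB_le _ _ (u (N k)))).
by have := NP k i (N k) Ni (leqnn _); lra.
Qed.

(** Riesz-Fischer: the partial sums are Cauchy, since the squared norm of a
    block of the series is a block of the convergent series of the [|a_k|^2]. *)
Lemma orthonormal_series_vcvg (e : nat -> V) (a : hardy R) :
  (forall i j, ip (e i) (e j) = (i == j)%:R) ->
  exists f, vcvg (fun N => \sum_(k < N) a k *: e k) f.
Proof.
move=> eo; apply: cauchy_vcvg => eps eps0.
have := coef_square_summable a; rewrite inE /sqsum => afin.
have a0 k : xpredT k -> (0 <= (sqnormc (a k))%:E)%E.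
  by move=> _; rewrite lee_fin sqnormc_ge0.
have /fine_cvgP[[N1 _ fin1]] := nneseries_tail_cvg afin a0.
move=> /cvgrPdist_le/(_ _ eps0)[N2 _ le2].
pose N := maxn N1 N2; exists N.
have tail i j : (N <= j)%N -> (j <= i)%N ->
    sqn (\sum_(k < i) a k *: e k - \sum_(k < j) a k *: e k) <= eps.
  move=> Nj ji; rewrite -!(big_mkord xpredT (fun k => a k *: e k)).
  rewrite (big_cat_nat (n := j))//= addrAC subrr add0r sqn_orthonormal_sum//.
  have := le2 N (leq_maxr _ _).
  rewrite /= sub0r normrN => /(le_trans (ler_norm _)).
  apply: le_trans; rewrite -lee_fin fineK; last by apply: fin1; exact: leq_maxl.
  apply: le_trans (nneseries_lim_ge i _) => [|k _ _]; last exact: a0.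
  rewrite sumEFin lee_fin (big_cat_nat Nj ji)/= lerDr.
  by apply: sumr_ge0 => k _; exact: sqnormc_ge0.
move=> i j Ni Nj; have [ji|/ltnW ij] := leqP j i; first exact: tail.
by rewrite -sqnN opprB; exact: tail.
Qed.

(** A minimizing sequence for the distance from [g] to [M] is Cauchy by the
    parallelogram identity. Near-minimality makes [g] minus its terms almost
    orthogonal to [M], because subtracting a multiple of an element of [M]
    cannot reduce the distance by much. *)
Lemma projection M g :
  (forall c f h, M f -> M h -> M (c *: f + h)) -> M 0 ->
  (forall u f, (forall N, M (u N)) -> vcvg u f -> M f) ->
  exists h, M h /\ forall f, M f -> ip (g - h) f = 0.
Proof.
move=> Mlin M0 Mclosed.
pose D := [set sqn (g - h) | h in M]; pose d := inf D.
have Dinf : has_inf D.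
  split; first by exists (sqn (g - 0)), 0.
  by exists 0 => _ [h _ <-]; exact: sqn_ge0.
have dle h : M h -> d <= sqn (g - h).
  by move=> Mh; apply: ge_inf; [case: Dinf|exists h].
have /choice[h hP] : forall k, exists h,
    M h /\ sqn (g - h) < d + 4^-1 ^+ k / 4.
  move=> k; have [|_ [h Mh <-] hlt] := @inf_adherent _ D (4^-1 ^+ k / 4) _ Dinf.
    by rewrite divr_gt0// exprn_gt0//; lra.
  by exists h.
have Mh k : M (h k) by case: (hP k).
have hlt k : sqn (g - h k) < d + 4^-1 ^+ k / 4 by case: (hP k).
have [k m km|l hl] := Vc (u := h).
  have le4 : 4^-1 ^+ m <= 4^-1 ^+ k :> R by rewrite ler_wiXn2l//; lra.
  have := parallelogram (g - h m) (g - h k).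
  rewrite (_ : g - h m - (g - h k) = h k - h m); last first.
    by rewrite opprB addrC addrA subrK.
  rewrite (_ : g - h m + (g - h k) = 2 *: (g - 2^-1 *: (h m + h k)));
    last first.
    rewrite scalerBr scalerA divff ?scale1r ?pnatr_eq0// scaler_nat mulr2n.
    by rewrite opprD addrACA.
  rewrite sqnZ (_ : sqnormc 2 = 4); last by rewrite /sqnormc/=; ring.
  have : d <= sqn (g - 2^-1 *: (h m + h k)).
    apply: dle; rewrite scalerDr; apply: (Mlin) => //.
    by rewrite -[_ *: _]addr0; apply: (Mlin).
  have := hlt k; have := hlt m; lra.
exists l; split; first exact: Mclosed hl.
move=> f Mf; have gl : vcvg (fun k => g - h k) (g - l).
  apply: cvg_trans hl; apply: near_eq_cvg; apply: nearW => k /=.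
  by rewrite -sqnN !opprB [g - h k + _]addrC addrA subrK.
apply: ccvg_unique (vcvg_ipl f gl) _.
apply: (@squeeze0 _ _ (fun k => 4^-1 ^+ k * (1 + sqn f))); last first.
  by rewrite -(mul0r (1 + sqn f)); apply: cvgMl; exact: geometric4_cvg0.
move=> k; rewrite sqnormc_ge0 subr0 /=.
(* With this step s * sqn f <= 1, so the quadratic term costs at most half of
   the gain of the linear one. *)
have f0 := sqn_ge0 f; pose s := (1 + sqn f)^-1.
have s0 : 0 < s by rewrite invr_gt0; lra.
have sf : s * sqn f <= 1 by rewrite mulrC ler_pdivrMr; lra.
rewrite -ler_pdivrMr; last lra.
have := sqn_sub_proj (g - h k) f s.
set c := sqnormc _; have c0 : 0 <= c by exact: sqnormc_ge0.
have : d <= sqn (g - h k - ((s%:C)%C * ip (g - h k) f) *: f).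
  rewrite -addrA -opprD; apply: dle; rewrite addrC; exact: (Mlin).
have : s ^+ 2 * c * sqn f <= s * c.
  by rewrite mulrAC expr2 -(mulrA s) ler_wpM2r// ler_piMr// ltW.
have : 0 <= 4^-1 ^+ k :> R by rewrite exprn_ge0//; lra.
by have := hlt k; rewrite -/s; lra.
Qed.

End complete.
End semi_inner_theory.

(** * Completeness of the square integrable functions *)

Section real_L2.
Context d (T : measurableType d) (R : realType).
Context (mu : {measure set T -> \bar R}).
Implicit Types (f g : T -> R).

Lemma Lfun2P f : f \in Lfun mu 2%:E <->
  measurable_fun [set: T] f /\ (\int[mu]_x (f x ^+ 2)%:E < +oo)%E.
Proof.
split=> [f2|[mf f2]].
  split; first by move: f2; rewrite inE => /andP[/[!inE]].
  exact: integrable_lty (Lfun2_integrable_sqr f2).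
rewrite inE; apply/andP; split; rewrite inE//= /finite_norm unlock.
apply: poweR_lty; apply: le_lt_trans f2; rewrite le_eqVlt; apply/orP; left.
apply/eqP/eq_integral => x _ /=.
by rewrite -[(2:R)]/(2%:R) powR_mulrn// real_normK// num_real.
Qed.

Lemma Lfun_measurable p f : f \in Lfun mu p -> measurable_fun [set: T] f.
Proof. by rewrite inE => /andP[/[!inE]]. Qed.

(** The square of the product is almost everywhere at most [M^2 g^2], where [M]
    is an essential bound of [|f|]. *)
Lemma LfunyM f g : f \in Lfun mu +oo%E -> g \in Lfun mu 2%:E ->
  (fun x => f x * g x) \in Lfun mu 2%:E.
Proof.
move=> fy /Lfun2P[mg g2].
have mf := Lfun_measurable fy.
have mfg : measurable_fun [set: T] (fun x => f x * g x).
  exact: measurable_funM.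
apply/Lfun2P; split => //.
move: fy; rewrite inE => /andP[_]; rewrite inE /= /finite_norm unlock.
have := measure_ge0 mu [set: T].
rewrite le_eqVlt => /predU1P[mu0 _|mu0].
  rewrite (_ : integral _ _ _ = 0%E) ?ltry//.
  apply: null_set_integral => //.
  by apply/measurable_EFinP; exact: measurable_funX.
rewrite mu0 => /ess_supr_bounded[M fM].
apply: (@le_lt_trans _ _ (\int[mu]_x ((M ^+ 2)%:E * (g x ^+ 2)%:E))%E).
  apply: ae_ge0_le_integral => //=.
  - by move=> x _; rewrite lee_fin sqr_ge0.
  - by apply/measurable_EFinP/measurable_funX.
  - by move=> x _; rewrite -EFinM lee_fin mulr_ge0 ?sqr_ge0.
  - by apply/measurable_EFinP/measurable_funM => //; exact: measurable_funX.
  - apply: filterS fM => x /= fM _; rewrite -EFinM lee_fin exprMn.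
    rewrite ler_wpM2r ?sqr_ge0// -real_normK ?num_real//.
    by rewrite lerXn2r ?nnegrE// (le_trans _ fM).
rewrite ge0_integralZl//; last 3 first.
- by apply/measurable_EFinP/measurable_funX.
- by move=> x _; rewrite lee_fin sqr_ge0.
- by rewrite lee_fin sqr_ge0.
by rewrite lte_mul_pinfty// lee_fin sqr_ge0.
Qed.

(** The weight [s] turns a geometric bound on squares into one on absolute
    values. *)
Lemma normr_le_weighted_sqr (s y : R) :
  0 < s -> `|y| <= (s^-1 + s * y ^+ 2) / 2.
Proof.
move=> s0; have : 0 <= s^-1 * (1 - s * `|y|) ^+ 2.
  by rewrite mulr_ge0 ?sqr_ge0// invr_ge0 ltW.
rewrite -(@real_normK _ y) ?num_real//.
have -> : s^-1 * (1 - s * `|y|) ^+ 2 = s^-1 + s * `|y| ^+ 2 - 2 * `|y|.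
  by field; rewrite gt_eqF.
lra.
Qed.

(** A sequence that is Cauchy at a geometric rate in [L^2] converges almost
    everywhere, because [\sum_k |u (k+1) - u k|] is finite almost everywhere;
    Fatou's lemma turns the pointwise limit into an [L^2] limit. *)
Lemma Lfun2_complete (u : nat -> T -> R) :
  (forall k, measurable_fun [set: T] (u k)) ->
  (forall k m, (k <= m)%N ->
    (\int[mu]_x ((u k x - u m x) ^+ 2)%:E <= (4^-1 ^+ k)%:E)%E) ->
  exists2 l : T -> R, measurable_fun [set: T] l &
    forall k, (\int[mu]_x ((u k x - l x) ^+ 2)%:E <= (4^-1 ^+ k)%:E)%E.
Proof.
move=> mfu uC.
(* The weight 2^k still leaves a summable bound 2^k 4^-k for the integrals. *)
pose w k x : \bar R := (2 ^+ k * (u k x - u k.+1 x) ^+ 2)%:E.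
have w0 k x : (0 <= w k x)%E by rewrite lee_fin mulr_ge0 ?sqr_ge0// exprn_ge0.
have mdiff k m : measurable_fun [set: T] (fun x => ((u k x - u m x) ^+ 2)%:E).
  by apply/measurable_EFinP/measurable_funX; exact: measurable_funB.
have mw k : measurable_fun [set: T] (w k).
  apply/measurable_EFinP/measurable_funM => //.
  by apply/measurable_funX; exact: measurable_funB.
pose G x := (\sum_(0 <= k <oo) w k x)%E.
have mG : measurable_fun [set: T] G.
  by apply: ge0_emeasurable_sum => // k x _ _; exact: w0.
have G0 x : (0 <= G x)%E by apply: nneseries_ge0 => k _ _; exact: w0.
have geo N : \sum_(0 <= k < N) 2^-1 ^+ k <= 2 :> R.
  elim: N => [|N IH]; first by rewrite big_geq.
  have : \sum_(0 <= k < N.+1) 2^-1 ^+ k = 2 - 2^-1 ^+ N :> R.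
    elim: N {IH} => [|N IH]; first by rewrite big_nat1 expr0; lra.
    by rewrite big_nat_recr//= IH exprS; lra.
  move=> ->; rewrite gerBl exprn_ge0//; lra.
have intG : (\int[mu]_x G x < +oo)%E.
  rewrite integral_nneseries//.
  apply: (@le_lt_trans _ _ 2%:E); last exact: ltry.
  apply: lime_le.
    by apply: is_cvg_nneseries => k _ _; exact: integral_ge0.
  apply: nearW => N; rewrite -[leRHS]/(2%:E).
  apply: (@le_trans _ _ (\sum_(0 <= k < N) (2^-1 ^+ k)%:E)%E); last first.
    by rewrite sumEFin lee_fin.
  apply: lee_sum => k _; rewrite /w.
  under eq_integral do rewrite EFinM.
  rewrite ge0_integralZl//; last by move=> x _; rewrite lee_fin sqr_ge0.
  rewrite (_ : (2^-1 ^+ k)%:E = (2 ^+ k)%:E * (4^-1 ^+ k)%:E)%E.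
    by rewrite lee_pmul2l ?lte_fin ?exprn_gt0//; exact: uC.
  by rewrite -EFinM -exprMn; congr (_ ^+ _)%:E; lra.
(* Cutting off outside E makes the convergence hold everywhere. *)
pose E := [set x | (G x < +oo)%E].
have mE : measurable E.
  by rewrite -[E]setTI; apply: emeasurable_fun_lt.
have aeE : \forall x \ae mu, E x.
  have : mu.-integrable [set: T] G.
    by apply/integrableP; split => //; under eq_integral do rewrite gee0_abs//.
  move=> /(integrable_ae measurableT); apply: filterS => x /(_ I).
  by rewrite ge0_fin_numE.
pose v k x := u k x * \1_E x.
have mv k : measurable_fun [set: T] (v k).
  by apply: measurable_funM => //; exact: measurable_indic.
have cv x : cvgn (v ^~ x).
  have [Ex|Ex] := pselect (E x); last first.
    rewrite /v indicE memNset//=.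
    by under eq_fun do rewrite mulr0; exact: is_cvg_cst.
  rewrite /v indicE mem_set//=; under eq_fun do rewrite mulr1.
  have : cvgn (series (fun k => u k.+1 x - u k x)).
    apply: normed_cvg; apply: nondecreasing_is_cvgn.
      by apply: nondecreasing_series => k _ _; exact: normr_ge0.
    exists ((2 + fine (G x)) / 2) => _ [N _ <-] /=.
    have wle : \sum_(0 <= k < N) 2 ^+ k * (u k x - u k.+1 x) ^+ 2 <= fine (G x).
      rewrite -lee_fin fineK ?ge0_fin_numE// -sumEFin.
      by apply: nneseries_lim_ge => k _ _; exact: w0.
    apply: (@le_trans _ _ (\sum_(0 <= k < N)
        (2^-1 ^+ k + 2 ^+ k * (u k x - u k.+1 x) ^+ 2) / 2)).
      apply: ler_sum => k _; rewrite distrC exprVn.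
      by apply: normr_le_weighted_sqr; rewrite exprn_gt0.
    rewrite -mulr_suml big_split/= ler_pM2r ?invr_gt0//.
    by have := geo N; lra.
  move=> /cvg_ex[l ul]; apply/cvg_ex; exists (l + u 0%N x).
  have -> : u ^~ x = (fun N => series (fun k => u k.+1 x - u k x) N + u 0%N x).
    by apply/funext => N; rewrite /series/= (telescope_sumr (u ^~ x))// subrK.
  by apply: cvgD => //; exact: cvg_cst.
pose l x := limn (v ^~ x).
have ml : measurable_fun [set: T] l.
  by apply: (@measurable_fun_cvg _ _ _ _ v) => // x _; exact: cv.
exists l => // k.
pose f m x := ((u k x - v (m + k)%N x) ^+ 2)%:E.
have mf m : measurable_fun [set: T] (f m).
  by apply/measurable_EFinP/measurable_funX; exact: measurable_funB.
have f0 m x : [set: T] x -> (0 <= f m x)%E by rewrite lee_fin sqr_ge0.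
have fE x : limn_einf (f ^~ x) = ((u k x - l x) ^+ 2)%:E.
  have : f ^~ x @ \oo --> ((u k x - l x) ^+ 2)%:E.
    apply: cvg_EFin; first exact: nearW.
    apply: (@cvg_comp _ _ _ (fun m => u k x - v (m + k)%N x)
      (fun y => y ^+ 2) _ (nbhs (u k x - l x))).
      apply: cvgB; first exact: cvg_cst.
      by rewrite (cvg_shiftn k (v ^~ x)); exact: cv.
    exact: exprn_continuous.
  by move=> /cvg_limn_einf_sup[].
under eq_integral do rewrite -fE.
apply: le_trans (fatou mu measurableT mf f0) _.
have intf m : (\int[mu]_x f m x <= (4^-1 ^+ k)%:E)%E.
  rewrite (_ : \int[mu]_x f m x =
    \int[mu]_x ((u k x - u (m + k)%N x) ^+ 2)%:E)%E.
    by apply: uC; exact: leq_addl.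
  apply: ae_eq_integral => //; apply: filterS aeE => x Ex _.
  by rewrite /f /v indicE mem_set// mulr1.
rewrite limn_einf_lim; apply: lime_le; first exact: is_cvg_einfs.
apply: nearW => m; apply: le_trans (intf m).
by apply: ereal_inf_lbound; exists m => //=.
Qed.

Lemma complex_Lfun2_complete (u : nat -> T -> R[i]) :
  (forall k, (fun t => Re (u k t)) \in Lfun mu 2%:E /\
             (fun t => Im (u k t)) \in Lfun mu 2%:E) ->
  (forall k m, (k <= m)%N ->
    (\int[mu]_x (sqnormc (u k x - u m x))%:E <= (4^-1 ^+ k)%:E)%E) ->
  exists l : T -> R[i], [/\ (fun t => Re (l t)) \in Lfun mu 2%:E,
    (fun t => Im (l t)) \in Lfun mu 2%:E &
    forall k, (\int[mu]_x (sqnormc (u k x - l x))%:E <= (2 * 4^-1 ^+ k)%:E)%E].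
Proof.
move=> u2 uC.
have mRe k : measurable_fun [set: T] (fun t => Re (u k t)).
  by case: (u2 k) => h _; exact: (Lfun_measurable h).
have mIm k : measurable_fun [set: T] (fun t => Im (u k t)).
  by case: (u2 k) => _ h; exact: (Lfun_measurable h).
have msq (v w : T -> R) :
    measurable_fun [set: T] v -> measurable_fun [set: T] w ->
    measurable_fun [set: T] (fun t => ((v t - w t) ^+ 2)%:E).
  move=> mv mw; apply/measurable_EFinP/measurable_funX.
  exact: measurable_funB.
have msqc k m : measurable_fun [set: T] (fun t => (sqnormc (u k t - u m t))%:E).
  rewrite /sqnormc; under eq_fun do rewrite !ReImE.
  by apply/measurable_EFinP/measurable_funD; apply: measurable_funX;
    apply: measurable_funB.
have le_sq (v : T -> R) k m : (k <= m)%N ->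
    measurable_fun [set: T] v ->
    (forall t, v t ^+ 2 <= sqnormc (u k t - u m t)) ->
    (\int[mu]_x (v x ^+ 2)%:E <= (4^-1 ^+ k)%:E)%E.
  move=> km mv vle; apply: le_trans (uC _ _ km); apply: ge0_le_integral => //.
  - by move=> t _; rewrite lee_fin sqr_ge0.
  - by apply/measurable_EFinP/measurable_funX.
  - by move=> t _; rewrite lee_fin.
have [//|k m km|a ma ha] := @Lfun2_complete (fun k t => Re (u k t)).
  apply: (le_sq (fun t => Re (u k t) - Re (u m t))) km _ _.
    exact: measurable_funB.
  by move=> t; rewrite /sqnormc !ReImE lerDl sqr_ge0.
have [//|k m km|b mb hb] := @Lfun2_complete (fun k t => Im (u k t)).
  apply: (le_sq (fun t => Im (u k t) - Im (u m t))) km _ _.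
    exact: measurable_funB.
  by move=> t; rewrite /sqnormc !ReImE lerDr sqr_ge0.
have L2lim (v w : T -> R) c : v \in Lfun mu 2%:E -> measurable_fun [set: T] w ->
    (\int[mu]_t ((v t - w t) ^+ 2)%:E <= c%:E)%E -> w \in Lfun mu 2%:E.
  move=> v2 mw vw.
  have vw2 : v - w \in Lfun mu 2%:E.
    apply/Lfun2P; split; last exact: le_lt_trans vw (ltry _).
    by apply: measurable_funB => //; exact: Lfun_measurable v2.
  have -> : w = (-1) *: (v - w) + v.
    by rewrite scaleN1r opprB subrK.
  have p1 : (1 <= 2%:E :> \bar R)%E by exact: lee1n.
  exact: (Lfun_submod_closed mu p1).2.
exists (fun t => Complex (a t) (b t)); split => /=.
- by case: (u2 0%N) => u0 _; exact: L2lim u0 ma (ha 0%N).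
- by case: (u2 0%N) => _ u0; exact: L2lim u0 mb (hb 0%N).
move=> k; rewrite /sqnormc; under eq_integral do rewrite !ReImE /= EFinD.
rewrite ge0_integralD//=.
- by rewrite mulrDl !mul1r EFinD; exact: leeD.
- by move=> t _; rewrite lee_fin sqr_ge0.
- exact: msq.
- by move=> t _; rewrite lee_fin sqr_ge0.
- exact: msq.
Qed.

End real_L2.

(** * The space L^2 of the circle *)

Section circle_L2.
Context {R : realType}.
Notation mu := (circle_measure R).
Notation CF := (R -> R[i]).
Implicit Types (f g : CF).

Lemma LT_linear p (p1 : (1 <= p)%E) (c : R[i]) f g :
  LT p f -> LT p g -> LT p (c *: f + g).
Proof.
have closed := Lfun_submod_closed mu p1.
have lin (a : R) u v : u \in Lfun mu p -> v \in Lfun mu p ->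
  (fun t => a * u t + v t) \in Lfun mu p by move=> ? ?; apply: closed.2.
move=> [rf imf] [rg img]; split.
- rewrite (_ : (fun t => _) = (fun t => Re c * Re (f t) +
    ((- Im c) * Im (f t) + Re (g t)))); first by do 2 apply: (lin) => //.
  by apply/funext => t; rewrite !ReImE; ring.
- rewrite (_ : (fun t => _) = (fun t => Re c * Im (f t) +
    (Im c * Re (f t) + Im (g t)))); first by do 2 apply: (lin) => //.
  by apply/funext => t; rewrite !ReImE; ring.
Qed.

Lemma LT0 p (p1 : (1 <= p)%E) : LT p (0 : CF).
Proof. by split; exact: (Lfun_submod_closed mu p1).1. Qed.

Lemma LTJ p (p1 : (1 <= p)%E) f : LT p f -> LT p (fun t => conjc (f t)).
Proof.
move=> [rf imf]; split.
  rewrite (_ : (fun t => _) = (fun t => Re (f t)))//.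
  by apply/funext => t; rewrite ReJ.
rewrite (_ : (fun t => _) = - (fun t => Im (f t))); last first.
  by apply/funext => t; rewrite ImJ.
by apply: Lfun_oppr_closed.
Qed.

Lemma LTy_sub2 f : LT +oo%E f -> LT 2%:E f.
Proof.
have sub : {subset Lfun mu +oo%E <= Lfun mu 2%:E}.
  apply: Lfun_subset; rewrite ?lee1n ?leey//.
  exact: fin_num_measure.
by move=> [rf imf]; split; exact: sub.
Qed.

Definition L2pred : {pred CF} := [pred f | f \in LT 2%:E].

Lemma L2pred_submod : submod_closed L2pred.
Proof.
have p1 : (1 <= 2%:E :> \bar R)%E by exact: lee1n.
split=> [|c f g]; rewrite ?unfold_in /=; first by apply/mem_set; exact: LT0.
move=> /set_mem f2 /set_mem g2; apply/mem_set; exact: LT_linear.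
Qed.

HB.instance Definition _ :=
  GRing.isSubmodClosed.Build R[i] CF L2pred L2pred_submod.

Record L2 := MkL2 { L2fun :> CF; L2funP : L2fun \in L2pred }.

HB.instance Definition _ := [isSub for L2fun].
HB.instance Definition _ := [Choice of L2 by <:].
HB.instance Definition _ := [SubChoice_isSubLmodule of L2 by <:].

Lemma L2_LT (f : L2) : LT 2%:E f.
Proof. exact: set_mem (L2funP f). Qed.

Lemma LT_L2 f : LT 2%:E f -> f \in L2pred.
Proof. exact: mem_set. Qed.

Definition cintegrable f :=
  mu.-integrable [set: R] (EFin \o (fun t => Re (f t))) /\
  mu.-integrable [set: R] (EFin \o (fun t => Im (f t))).

Lemma intT_linear (c : R[i]) f g : cintegrable f -> cintegrable g ->
  intT (fun t => c * f t + g t) = c * intT f + intT g.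
Proof.
move=> [rf imf] [rg img].
have Z (a : R) u : mu.-integrable [set: R] (EFin \o u) ->
    mu.-integrable [set: R] (EFin \o (fun t => a * u t)).
  by move=> iu; exact: (integrableZl measurableT a iu).
have D (a b : R) u v w : mu.-integrable [set: R] (EFin \o u) ->
    mu.-integrable [set: R] (EFin \o v) ->
    mu.-integrable [set: R] (EFin \o w) ->
  \int[mu]_t (a * u t + (b * v t + w t)) =
    a * \int[mu]_t u t + (b * \int[mu]_t v t + \int[mu]_t w t).
  move=> iu iv iw; rewrite RintegralD ?RintegralD ?RintegralZl//; try exact: Z.
  exact: (integrableD measurableT (Z _ _ iv) iw).
apply: complex_ext; rewrite !ReImE /=.
  rewrite (_ : (fun t => _) = (fun t => Re c * Re (f t) +
    ((- Im c) * Im (f t) + Re (g t)))).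
    by rewrite D//; ring.
  by apply/funext => t; rewrite !ReImE; ring.
rewrite (_ : (fun t => _) = (fun t => Re c * Im (f t) +
    (Im c * Re (f t) + Im (g t)))).
  by rewrite D//; ring.
by apply/funext => t; rewrite !ReImE; ring.
Qed.

Lemma intTJ f : cintegrable f -> intT (fun t => conjc (f t)) = conjc (intT f).
Proof.
move=> [rf imf]; apply: complex_ext; rewrite !ReImE /=.
  by apply: eq_Rintegral => t _; rewrite ReJ.
rewrite -mulN1r -RintegralZl//.
by apply: eq_Rintegral => t _; rewrite ImJ mulN1r.
Qed.

Lemma L2_mul_cintegrable f g : LT 2%:E f -> LT 2%:E g ->
  cintegrable (fun t => f t * conjc (g t)).
Proof.
move=> [rf imf] [rg img].
have M u v : u \in Lfun mu 2%:E -> v \in Lfun mu 2%:E ->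
    mu.-integrable [set: R] (EFin \o (fun t => u t * v t)).
  by move=> u2 v2; apply/Lfun1_integrable; exact: Lfun2_mul_Lfun1.
split.
  rewrite (_ : (fun t => _) =
    (fun t => Re (f t) * Re (g t) + Im (f t) * Im (g t))).
    exact: (integrableD measurableT (M _ _ rf rg) (M _ _ imf img)).
  by apply/funext => t; rewrite !ReImE mulrN opprK.
rewrite (_ : (fun t => _) =
    (fun t => Im (f t) * Re (g t) - Re (f t) * Im (g t))).
  exact: (integrableB measurableT (M _ _ imf rg) (M _ _ rf img)).
by apply/funext => t; rewrite !ReImE mulrN addrC.
Qed.

Definition L2ip (f g : L2) : R[i] := dotT f g.

Lemma L2ip_linear c (f g h : L2) :
  L2ip (c *: f + g) h = c * L2ip f h + L2ip g h.
Proof.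
rewrite /L2ip /dotT -intT_linear;
  [|exact: L2_mul_cintegrable (L2_LT _) (L2_LT _)..].
by congr intT; apply/funext => t; rewrite mulrA -mulrDl.
Qed.

Lemma L2ipC (f g : L2) : L2ip f g = conjc (L2ip g f).
Proof.
rewrite /L2ip /dotT -intTJ; last exact: L2_mul_cintegrable (L2_LT _) (L2_LT _).
by congr intT; apply/funext => t; rewrite rmorphM [RHS]mulrC /= conjcK.
Qed.

Lemma L2ip_ge0 (f : L2) : 0 <= Re (L2ip f f).
Proof. by apply: Rintegral_ge0 => t _; rewrite sqnormcE /= sqnormc_ge0. Qed.

Definition L2_inner : semi_inner L2 := SemiInner L2ip_linear L2ipC L2ip_ge0.

Lemma sqnormTE (f : L2) : sqnormT f = (sqn L2_inner f)%:E.
Proof.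
have [/integrable_fin_num h _] := L2_mul_cintegrable (L2_LT f) (L2_LT f).
have {}h := h measurableT.
rewrite /sqnormT /sqn /= /L2ip /dotT /intT /= /Rintegral.
rewrite (_ : (fun t => _) =
  EFin \o (fun t : R => complex.Re (f t * conjc (f t)))) ?fineK//.
by apply/funext => t /=; rewrite sqnormcE.
Qed.

Lemma L2_complete : complete_semi_inner L2_inner.
Proof.
move=> u uC.
have [k|k m km|l [rl il hl]] := @complex_Lfun2_complete _ _ _ mu (fun k => u k).
- exact: L2_LT.
- by rewrite -[X in (X <= _)%E]/(sqnormT (u k - u m)) sqnormTE lee_fin uC.
exists (MkL2 (LT_L2 (conj rl il))).
apply: (@squeeze0 _ _ (fun k => 2 * 4^-1 ^+ k)); last first.
  by rewrite -(mulr0 2); apply: cvgMr; exact: geometric4_cvg0.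
by move=> k; rewrite sqn_ge0 -lee_fin -sqnormTE; exact: hl.
Qed.

Lemma bounded_mulP (phi : CF) (f : L2) : LT +oo%E phi ->
  (fun t => phi t * f t) \in L2pred.
Proof.
move=> [rp ip]; apply: LT_L2; have [rf imf] := L2_LT f.
have p1 : (1 <= 2%:E :> \bar R)%E by exact: lee1n.
have closed := (Lfun_submod_closed mu p1).2.
split.
  rewrite (_ : (fun t => _) = (-1) *: (fun t => Im (phi t) * Im (f t)) +
    (fun t => Re (phi t) * Re (f t))).
    by apply: closed; exact: LfunyM.
  by apply/funext => t; rewrite !ReImE /= fctE /= scaleN1r addrC.
rewrite (_ : (fun t => _) = 1 *: (fun t => Im (phi t) * Re (f t)) +
    (fun t => Re (phi t) * Im (f t))).
  by apply: closed; exact: LfunyM.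
by apply/funext => t; rewrite !ReImE /= scale1r addrC.
Qed.

End circle_L2.
Arguments L2 : clear implicits.

(** * Exponentials *)

Section characters.
Context {R : realType}.
Notation mu := (circle_measure R).
Implicit Types (s t : R) (k : int).

Lemma expiD s t : expi (s + t) = expi s * expi t.
Proof.
by apply: complex_ext; rewrite !ReImE /= ?cosD ?sinD// addrC [X in X + _]mulrC.
Qed.

Lemma expi0 : expi (0 : R) = 1.
Proof. by rewrite /expi cos0 sin0. Qed.

Lemma expi_neq0 t : expi t != 0.
Proof.
apply/eqP => t0; have := expiD t (- t).
by rewrite subrr expi0 t0 mul0r => /eqP; rewrite oner_eq0.
Qed.

Lemma expiN t : expi (- t) = (expi t)^-1.
Proof.
by apply: (mulfI (expi_neq0 t)); rewrite -expiD subrr expi0 divff// expi_neq0.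
Qed.

Lemma expiX t k : expi t ^ k = expi (k%:~R * t).
Proof.
have nat_case m : expi t ^+ m = expi (m%:R * t).
  elim: m => [|m IH]; first by rewrite mul0r expi0.
  by rewrite exprS IH -expiD -natr1 mulrDl mul1r addrC.
case: k => m; first by rewrite -exprnP nat_case.
by rewrite NegzE -exprnN nat_case mulrNz mulNr expiN.
Qed.

Lemma conj_expiX t k : conjc (expi t ^ k) = expi t ^ (- k).
Proof.
rewrite !expiX mulrNz mulNr.
by apply: complex_ext; rewrite ?ReJ ?ImJ /= ?cosN ?sinN.
Qed.

Lemma expi_periodic k : expi (k%:~R * (2 * pi)) = 1 :> R[i].
Proof.
rewrite -expiX (_ : expi (2 * pi) = 1) ?exp1rz//.
by rewrite mulr_natl /expi cos2pi sin2pi.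
Qed.

(** Adding [1] makes the integrand nonnegative, the case in which integrals
    against the uniform distribution are computed by its density. *)
Lemma circle_int_derivative (F f : R -> R) :
  (forall t, is_derive t 1 F (f t)) -> continuous f ->
  (forall t, `|f t| <= 1) ->
  F (2 * pi) = F 0 -> \int[mu]_t f t = 0.
Proof.
move=> dF cf f1 Fper.
have mf : measurable_fun [set: measurableTypeR R] f.
  exact: continuous_measurable_fun.
have iF : (\int[mu]_t (f t + 1)%:E = 1%:E)%E.
  rewrite /circle_measure integral_uniform.
  - rewrite [X in (_ * X)%E](_ : _ = (2 * pi)%:E).
      by rewrite subr0 -EFinM mulVf// gt_eqF// twopi_gt0.
    have dG t : is_derive t 1 (fun t => F t + t) (f t + 1) by exact: is_deriveD.
    rewrite (@continuous_FTC2 _ _ (fun t => F t + t))//.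
    + by rewrite -EFinB Fper; congr EFin; ring.
    + exact: twopi_gt0.
    + apply: continuous_subspaceT => t; apply: cvgD; first exact: cf.
      exact: cvg_cst.
    + have cG : continuous (fun t => F t + t).
        move=> t; apply: differentiable_continuous.
        by apply/derivable1_diffP; apply: ex_derive.
      split.
      * by move=> t _; apply: ex_derive.
      * exact/cvg_at_right_filter/cG.
      * exact/cvg_at_left_filter/cG.
    + by move=> t _; rewrite derive1E; apply: derive_val.
  - by apply/measurable_EFinP/measurable_funD.
  - move=> t; rewrite lee_fin; have := f1 t; rewrite ler_norml => /andP[]; lra.
have fint : mu.-integrable [set: R] (EFin \o f).
  apply: measurable_bounded_integrable => //.
    by rewrite -ge0_fin_numE//; exact: fin_num_measure.
  exists 1; split; first exact: num_real.
  by move=> y y1 t _; apply: le_trans (f1 t) _; exact: ltW.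
have : \int[mu]_t (f t + 1) = 1 by rewrite /Rintegral iF.
rewrite RintegralD//; last exact: finite_measure_integrable_cst.
rewrite Rintegral_cst// mul1r.
have -> : fine (mu [set: R]) = 1 by rewrite probability_setT.
lra.
Qed.

Lemma continuous_expiX k :
  continuous (fun t : R => cos (k%:~R * t)) /\
  continuous (fun t : R => sin (k%:~R * t)).
Proof.
have lin : continuous (fun t : R => k%:~R * t).
  by move=> t; apply: cvgMr; exact: cvg_id.
split=> t; apply: (cvg_comp _ _ (lin t)).
  exact: continuous_cos.
exact: continuous_sin.
Qed.

Lemma intT_expiX k : intT (fun t : R => expi t ^ k) = (k == 0)%:R.
Proof.
rewrite (_ : (fun t => _) = fun t => expi (k%:~R * t)); last first.
  by apply/funext => t; rewrite expiX.
have [->|k0] := eqVneq k 0.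
  rewrite (_ : (fun t => _) = fun=> 1); last first.
    by apply/funext => t; rewrite mul0r expi0.
  apply: complex_ext => /=; rewrite Rintegral_cst//.
    by rewrite mul1r -[fine _]/(fine (mu [set: R])) probability_setT.
  by rewrite mul0r.
have kR0 : (k%:~R : R) != 0 by rewrite intr_eq0.
have [cc cs] := continuous_expiX k.
have lin t : is_derive t 1 (fun t : R => k%:~R * t) k%:~R.
  have := @is_deriveZ _ _ _ (@id R) (k%:~R) t 1 1 _.
  by rewrite /GRing.scale /= mulr1; apply.
have per := expi_periodic k.
apply: complex_ext => /=.
- apply: (@circle_int_derivative (fun t => k%:~R^-1 * sin (k%:~R * t))) => //.
  + move=> t; have h := is_derive1_comp (is_derive_sin (k%:~R * t)) (lin t).
    have := @is_deriveZ _ _ _ _ (k%:~R^-1) t 1 _ h.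
    by rewrite /GRing.scale /= mulrCA mulVf// mulr1.
  + by move=> t; exact: cos_max.
  + by rewrite mulr0 sin0; have := congr1 (@complex.Im R) per; rewrite /= => ->.
- apply: (@circle_int_derivative (fun t => - k%:~R^-1 * cos (k%:~R * t))) => //.
  + move=> t; have h := is_derive1_comp (is_derive_cos (k%:~R * t)) (lin t).
    have := @is_deriveZ _ _ _ _ (- k%:~R^-1) t 1 _ h.
    by rewrite /GRing.scale /= mulrCA (mulNr (k%:~R^-1)) mulVf// mulrNN mulr1.
  + by move=> t; exact: sin_max.
  + by rewrite mulr0 cos0; have := congr1 (@complex.Re R) per; rewrite /= => ->.
Qed.

Lemma expiX_L2 k : (fun t : R => expi t ^ k) \in @L2pred R.
Proof.
rewrite (_ : (fun t => _) = fun t => expi (k%:~R * t)); last first.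
  by apply/funext => t; rewrite expiX.
have [cc cs] := continuous_expiX k.
have bounded_L2 (f : R -> R) : continuous f -> (forall t, `|f t| <= 1) ->
    f \in Lfun mu 2%:E.
  move=> cf f1; apply/Lfun2P; split; first exact: continuous_measurable_fun.
  apply: (@le_lt_trans _ _ (\int[mu]_(t in [set: R]) (cst 1%:E t))%E).
    apply: ge0_le_integral => //.
    - by move=> t _; rewrite lee_fin sqr_ge0.
    - apply/measurable_EFinP/measurable_funX.
      exact: continuous_measurable_fun.
    - by move=> t _; rewrite lee_fin -real_normK ?num_real// expr_le1.
  by rewrite integral_cst// mul1e -ge0_fin_numE//; exact: fin_num_measure.
apply: LT_L2; split; apply: bounded_L2 => //= t; first exact: cos_max.
exact: sin_max.
Qed.

Definition expiL2 k : L2 R := MkL2 (expiX_L2 k).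

Lemma fourierE (f : L2 R) k : fourier f k = L2_inner f (expiL2 k).
Proof. by congr intT; apply/funext => t; rewrite conj_expiX. Qed.

Lemma expiL2_orthonormal j k : L2_inner (expiL2 j) (expiL2 k) = (j == k)%:R.
Proof.
rewrite -subr_eq0 -intT_expiX; congr intT; apply/funext => t.
by rewrite /= conj_expiX expfzDr ?expi_neq0.
Qed.

End characters.

(** * Toeplitz operators as compressions of multiplications *)

Section toeplitz_entries.
Context {R : realType}.
Notation ip := (@L2_inner R).
Implicit Types (f g : hardy R) (F G H : L2 R) (h : R -> R[i]).

Lemma expiL2_nat_orthonormal (i j : nat) :
  ip (expiL2 i) (expiL2 j) = (i == j)%:R.
Proof. exact: expiL2_orthonormal. Qed.

Definition partial_sum f (N : nat) : L2 R := \sum_(k < N) f k *: expiL2 k.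

Lemma partial_sumE f N t : partial_sum f N t = \sum_(k < N) f k * expi t ^+ k.
Proof.
rewrite /partial_sum -[LHS]/((L2fun _ : R -> R[i]) t).
elim: N => [|N IH]; first by rewrite !big_ord0.
rewrite !big_ord_recr /= -IH.
by [].
Qed.

Lemma sqnormT_partial_sum f F N :
  sqnormT (fun t => F t - \sum_(k < N) f k * expi t ^+ k) =
  (sqn ip (partial_sum f N - F))%:E.
Proof.
rewrite -sqnN opprB -sqnormTE; congr sqnormT.
by apply/funext => t; rewrite -partial_sumE.
Qed.

(** The defining property of [boundary] is satisfiable, by Riesz-Fischer. *)
Lemma boundary_spec f : LT 2%:E (boundary f) /\
  sqnormT (fun t => boundary f t - \sum_(k < N) f k * expi t ^+ k)
    @[N --> \oo] --> 0%E.
Proof.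
have [F Ff] := orthonormal_series_vcvg L2_complete f expiL2_nat_orthonormal.
rewrite /boundary; set S := [set _ | _].
suff : S (xget (fun=> 0) S) by [].
apply: xgetPex; exists (F : R -> R[i]); split; first exact: L2_LT.
under eq_fun do rewrite sqnormT_partial_sum.
by apply: cvg_EFin => //; exact: nearW.
Qed.

Definition boundaryL2 f : L2 R := MkL2 (LT_L2 (boundary_spec f).1).

Lemma boundaryL2_vcvg f : vcvg ip (partial_sum f) (boundaryL2 f).
Proof.
have := (boundary_spec f).2.
under eq_fun do rewrite (sqnormT_partial_sum f (boundaryL2 f)).
by move=> /fine_cvg.
Qed.

Lemma coef_boundaryL2_ccvg f F :
  ccvg (fun N => \sum_(k < N) f k * ip (expiL2 k) F) (ip (boundaryL2 f) F).
Proof.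
have := vcvg_ipl F (boundaryL2_vcvg f); apply: ccvg_near; apply: nearW => N.
by rewrite ip_suml; apply: eq_bigr => k _; rewrite ipZl.
Qed.

Definition hardy_coefs F : hardy R :=
  Hardy (bessel_square_summable expiL2_nat_orthonormal F).

(** [hardyT] is closed because Fourier coefficients are continuous, so the
    projection exists; as [hardyT] contains the exponentials of nonnegative
    frequency, projecting preserves the coefficients of these frequencies. *)
Lemma proj_hardyT_coef F (k : nat) :
  hardyT (proj_hardyT F) /\
  fourier (proj_hardyT F) k = ip F (expiL2 k).
Proof.
pose M (G : L2 R) := forall k : int, k < 0 -> ip G (expiL2 k) = 0.
have [|||H [MH FH]] := @projection _ _ ip L2_complete M F.
- by move=> c G H MG MH j j0; rewrite ipDZl MG// MH// mulr0 addr0.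
- by move=> j j0; rewrite ip0l.
- move=> u G Mu uG j j0; apply: ccvg_unique (vcvg_ipl (expiL2 j) uG) _.
  by under eq_fun do rewrite Mu//; exact: ccvg_cst.
have [hT orth] : hardyT (proj_hardyT F) /\ forall u, hardyT u ->
    dotT (fun t => F t - proj_hardyT F t) u = 0.
  rewrite /proj_hardyT; set S := [set _ | _].
  suff : S (xget (fun=> 0) S) by [].
  apply: xgetPex; exists (H : R -> R[i]); split.
    by split=> [|j j0]; [exact: L2_LT|rewrite fourierE; exact: MH].
  move=> u [u2 u0]; apply: (FH (MkL2 (LT_L2 u2))) => j j0.
  by rewrite -fourierE; exact: u0.
split=> //; pose P := MkL2 (LT_L2 hT.1).
have ek : hardyT (expiL2 k : R -> R[i]).
  split=> [|j j0]; first exact: L2_LT.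
  by rewrite fourierE expiL2_orthonormal gt_eqF// (lt_le_trans j0).
have := orth _ ek; rewrite -[dotT _ _]/(ip (F - P) (expiL2 k)) ipBl => /eqP.
rewrite subr_eq0 => /eqP ->.
by rewrite -[proj_hardyT F]/(P : R -> R[i]) fourierE.
Qed.

Section symbol.
Context (phi : R -> R[i]) (phiy : LT +oo%E phi).

Definition mulL2 F : L2 R := MkL2 (bounded_mulP F phiy).

(** The adjoint is the multiplication by the conjugate symbol.
    It makes the form [ip (mulL2 F) G] continuous in [F]. *)
Lemma mulL2_adjoint : exists A : L2 R -> L2 R,
  forall F G, ip (mulL2 F) G = ip F (A G).
Proof.
exists (fun G => MkL2 (bounded_mulP G (LTJ (leey 1) phiy))) => F G.
congr intT; apply/funext => t /=.
by rewrite rmorphM /= conjcK mulrCA mulrA.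
Qed.

Lemma mulL2_expiL2 (i j : nat) :
  ip (mulL2 (expiL2 j)) (expiL2 i) = fourier phi (i%:Z - j%:Z).
Proof.
congr intT; apply/funext => t /=.
by rewrite conj_expiX -mulrA -expfzDr ?expi_neq0// opprB.
Qed.

Lemma coef_mulL2_ccvg f F :
  ccvg (fun N => \sum_(k < N) f k * ip (mulL2 (expiL2 k)) F)
    (ip (mulL2 (boundaryL2 f)) F).
Proof.
have [A adj] := mulL2_adjoint; rewrite adj.
apply: ccvg_near (coef_boundaryL2_ccvg f (A F)); apply: nearW => N.
by apply: eq_bigr => k _; rewrite adj.
Qed.

Lemma toeplitz_coef f (k : nat) :
  toeplitz phi f k = ip (mulL2 (boundaryL2 f)) (expiL2 k).
Proof.
pose F := mulL2 (boundaryL2 f).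
have [hT _] := proj_hardyT_coef F 0.
have spec : forall k : nat, toeplitz phi f k = fourier (proj_hardyT F) k.
  rewrite /toeplitz /power_series -/(F : R -> R[i]).
  apply: (@xgetPex _ 0
    [set f : hardy R | forall k : nat, f k = fourier (proj_hardyT F) k]).
  by exists (hardy_coefs F) => j; rewrite (proj_hardyT_coef F j).2.
by rewrite spec (proj_hardyT_coef F k).2.
Qed.

(** The projection is orthogonal and [g] belongs to its range. The right-hand
    side is continuous in both boundary functions, whereas the double series of
    the matrix entries need not converge absolutely. *)
Lemma hdot_toeplitz f g :
  hdot (toeplitz phi f) g = ip (mulL2 (boundaryL2 f)) (boundaryL2 g).
Proof.
apply: cseries_ccvg.
have := vcvg_ipr (mulL2 (boundaryL2 f)) (boundaryL2_vcvg g).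
apply: ccvg_near; apply: nearW => N; rewrite ip_sumr; apply: eq_bigr => k _.
by rewrite ipZr mulrC toeplitz_coef.
Qed.

End symbol.

End toeplitz_entries.

(** * Complex symmetry in terms of Fourier coefficients *)

Section unit_sequences.
Context {R : realType}.
Notation ip := (@L2_inner R).

Definition unit_seq (j : nat) : hardy R := hardy_coefs (expiL2 j).

Lemma unit_seqE (j k : nat) : unit_seq j k = (j == k)%:R.
Proof. exact: expiL2_nat_orthonormal. Qed.

Lemma ccvg_partial_unit (u : nat -> R[i]) (j : nat) :
  ccvg (fun N => \sum_(k < N) u k * unit_seq j k) (u j).
Proof.
apply: (@ccvg_near _ (fun=> u j)); last first.
  exact: ccvg_cst.
near=> N.
have jN : (j < N)%N by near: N; exact: nbhs_infty_gt.
under eq_bigr do rewrite unit_seqE.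
rewrite (bigD1 (Ordinal jN))//= eqxx mulr1 big1 ?addr0// => i ij.
rewrite (_ : (j == i :> nat) = false) ?mulr0//.
by apply/negbTE; rewrite eq_sym; exact: ij.
Unshelve. all: by end_near.
Qed.

Lemma hdot_unitr (f : hardy R) j : hdot f (unit_seq j) = f j.
Proof.
apply: cseries_ccvg; apply: ccvg_near (ccvg_partial_unit f j).
by apply: nearW => N; apply: eq_bigr => k _; rewrite unit_seqE rmorph_nat.
Qed.

Lemma hdot_unitl (f : hardy R) j : hdot (unit_seq j) f = conjc (f j).
Proof.
apply: cseries_ccvg.
apply: ccvg_near (ccvg_partial_unit (fun k => conjc (f k)) j).
by apply: nearW => N; apply: eq_bigr => k _; rewrite mulrC.
Qed.

Lemma toeplitz_unit (phi : R -> R[i]) (phiy : LT +oo%E phi) (i j : nat) :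
  toeplitz phi (unit_seq j) i = fourier phi (i%:Z - j%:Z).
Proof.
rewrite toeplitz_coef -(mulL2_expiL2 phiy).
apply: ccvg_unique (coef_mulL2_ccvg phiy _ _) _.
apply: ccvg_near
  (ccvg_partial_unit (fun k => ip (mulL2 phiy (expiL2 k)) (expiL2 i)) j).
by apply: nearW => N; apply: eq_bigr => k _; rewrite mulrC.
Qed.

Lemma fourier_ccvg0 (phi : R -> R[i]) : LT +oo%E phi ->
  ccvg (fun k : nat => fourier phi k) 0.
Proof.
move=> phiy; pose F := MkL2 (LT_L2 (LTy_sub2 phiy)).
have := bessel_ccvg0 (@expiL2_nat_orthonormal R) F.
apply: ccvg_near; apply: nearW => k.
by rewrite -fourierE.
Qed.

End unit_sequences.

Section flip_sums.
Context (n : nat) (n1 : (1 <= n)%N).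

Lemma flip_lt (N i : nat) : (i < n * N)%N -> (flip n i < n * N)%N.
Proof.
move=> iN; have iq : (i %/ n < N)%N by rewrite ltn_divLR// mulnC.
apply: (@leq_trans (n * (i %/ n).+1)); last by rewrite leq_mul2l iq orbT.
by rewrite /flip mulnS addnC ltn_add2r; lia.
Qed.

Lemma sum_flip (V : nmodType) (F : nat -> V) (N : nat) :
  \sum_(i < n * N) F (flip n i) = \sum_(i < n * N) F i.
Proof.
pose h (i : 'I_(n * N)) := Ordinal (flip_lt (ltn_ord i)).
rewrite [RHS](reindex_inj (h := h))//.
by apply: (inv_inj (f := h)) => i; apply: val_inj; exact: flipK.
Qed.

End flip_sums.

Section complex_symmetry.
Context {R : realType} (n : nat) (n1 : (1 <= n)%N).
Context (phi : R -> R[i]) (phiy : LT +oo%E phi).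
Notation ip := (@L2_inner R).

(** The matrix of [T_phi] has entry [fourier phi (i - j)] at [(i, j)]; the
    conjugation [C_n] permutes the basis by [flip n], so this compares the
    entries of [T_phi] with those of the adjoint of [C_n T_phi C_n]. *)
Definition flip_symmetric := forall i j : nat,
  fourier phi (i%:Z - j%:Z) = fourier phi ((flip n j)%:Z - (flip n i)%:Z).

Lemma Cn_unit (i : nat) : Cn R n1 (unit_seq i) = unit_seq (flip n i).
Proof.
apply/val_inj/funext => k; rewrite -[LHS]/(conjc (unit_seq i (flip n k))).
rewrite -[RHS]/(unit_seq (flip n i) k) !unit_seqE rmorph_nat.
by rewrite -(inj_eq (inv_inj (flipK n1)) i) flipK.
Qed.

(** Basis vectors give the direct implication. Conversely, both sides
    are limits of sums of matrix entries over the partial sums of [f] and [g],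
    and the symmetry turns the entries of one side into those of the other. *)
Lemma complex_symmetric_flip :
  complex_symmetric (Cn R n1) (toeplitz phi) <-> flip_symmetric.
Proof.
split=> [sym i j|sym f g].
  rewrite -(toeplitz_unit phiy) -(hdot_unitr (toeplitz phi (unit_seq j)) i).
  rewrite sym hdot_unitl -[Cn R n1 _ j]/(conjc (toeplitz phi _ (flip n j))).
  by rewrite conjcK Cn_unit toeplitz_unit.
rewrite (hdot_toeplitz phiy); apply/esym/cseries_ccvg.
apply: ccvg_near (coef_mulL2_ccvg phiy f (boundaryL2 g)).
apply: nearW => N; apply: eq_bigr => k _; congr (_ * _).
rewrite -[Cn R n1 _ k]/(conjc (toeplitz phi (Cn R n1 g) (flip n k))) conjcK.
rewrite (toeplitz_coef phiy).
(* flip n permutes the first n * N indices, so limits are taken along the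
   multiples of n. *)
have blocks : (fun N => n * N)%N @ \oo --> \oo.
  apply/cvgnyPge => A; exists A => // m /= Am.
  by rewrite (leq_trans Am)// leq_pmull.
apply: ccvg_unique (ccvg_comp blocks (vcvg_ipr _ (boundaryL2_vcvg g))) _.
apply: ccvg_near (ccvg_comp blocks (coef_mulL2_ccvg phiy _ _)).
apply: nearW => K; rewrite /comp /partial_sum ip_sumr.
rewrite -(sum_flip n1 (fun i =>
  Cn R n1 g i * ip (mulL2 phiy (expiL2 i)) (expiL2 (flip n k)))).
apply: eq_bigr => i _; rewrite ipZr !mulL2_expiL2 -sym.
by rewrite /= /Cn_coef flipK.
Qed.

(** Coefficients that recur with period [2 n] along a progression are equal to
    coefficients of arbitrarily high frequency, and these tend to zero. *)
Lemma fourier_progression_eq0 (r l : int) :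
  (forall m : int,
    fourier phi (r + n%:Z * (m + 2)) = fourier phi (r + n%:Z * m)) ->
  fourier phi (r + n%:Z * l) = 0.
Proof.
move=> per2.
have per (p : nat) :
    fourier phi (r + n%:Z * (l + 2 * p%:Z)) = fourier phi (r + n%:Z * l).
  elim: p => [|p IH]; first by rewrite mulr0 addr0.
  by rewrite -IH -(per2 (l + 2 * p%:Z)); congr (fourier _ (_ + _ * _)); lia.
(* The shift by |r| + |l| makes these frequencies nonnegative. *)
pose s (p : nat) : nat :=
  absz (r + n%:Z * (l + 2 * (p + absz r + absz l)%N%:Z)).
have sE p : (s p)%:Z = r + n%:Z * (l + 2 * (p + absz r + absz l)%N%:Z).
  by rewrite /s; nia.
have sp p : (p <= s p)%N by have := sE p; nia.
have soo : s @ \oo --> \oo.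
  by apply/cvgnyPge => A; exists A => // m /= Am; exact: leq_trans Am (sp m).
have c0 : ccvg (fun=> fourier phi (r + n%:Z * l)) 0.
  apply: ccvg_near (ccvg_comp soo (fourier_ccvg0 phiy)); apply: nearW => p /=.
  by rewrite sE per.
exact: ccvg_unique (ccvg_cst _) c0.
Qed.

(** Writing [i = n k + m] and [j = n k' + m'], the symmetry reads
    [fourier phi (s + n l) = fourier phi (s - n l)] for [|s| < n]. On the
    progression [r + n Z] with [0 < r < n] both [s = r] and [s = r - n] apply:
    these are two reflections of the progression, and their composition is the
    translation by [2 n]. *)
Lemma flip_symmetricP : flip_symmetric <->
  (forall l : int, fourier phi (n%:Z * l) = fourier phi (- (n%:Z * l))) /\
  (forall l r : int, 1 <= r <= n%:Z - 1 -> fourier phi (r + n%:Z * l) = 0).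
Proof.
split=> [sym|[even zero] i j].
  have reflection (l s : int) : - n%:Z < s < n%:Z ->
      fourier phi (s + n%:Z * l) = fourier phi (s - n%:Z * l).
    move=> sn.
    have [m [m' [mn m'n sE]]] : exists m m' : nat,
        [/\ (m < n)%N, (m' < n)%N & s = m%:Z - m'%:Z].
      have [s0|s0] := leP 0 s; first by exists `|s|%N, 0%N; split; lia.
      by exists 0%N, `|s|%N; split; lia.
    have [k [k' lE]] : exists k k' : nat, l = k%:Z - k'%:Z.
      have [l0|l0] := leP 0 l; first by exists `|l|%N, 0%N; lia.
      by exists 0%N, `|l|%N; lia.
    have := sym (n * k + m)%N (n * k' + m')%N; rewrite !flipE//.
    by rewrite sE lE => h; etransitivity; [|etransitivity; [exact: h|]];
      congr fourier; nia.
  split=> [l|l r rn].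
    by have := reflection l 0; rewrite !add0r; apply; lia.
  apply: fourier_progression_eq0 => m.
  have := reflection (m + 2) r.
  rewrite (_ : r - n%:Z * (m + 2) = r - n%:Z + n%:Z * (- (m + 1))); last lia.
  move=> ->; last lia.
  rewrite reflection; last lia.
  by congr fourier; lia.
set m := (i %% n)%N; set k := (i %/ n)%N.
set m' := (j %% n)%N; set k' := (j %/ n)%N.
have mn : (m < n)%N by rewrite ltn_mod.
have m'n : (m' < n)%N by rewrite ltn_mod.
have iE : i = (n * k + m)%N by rewrite mulnC -divn_eq.
have jE : j = (n * k' + m')%N by rewrite mulnC -divn_eq.
have fiE : flip n i = (n * k + (n - m - 1))%N by rewrite iE flipE.
have fjE : flip n j = (n * k' + (n - m' - 1))%N by rewrite jE flipE.
rewrite fiE fjE iE jE.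
have [mm'|mm'|mm'] := ltngtP m m'.
- (* Here m - m' < 0, and r = n + m - m'. *)
  rewrite (_ : _ - _ = (n%:Z + m%:Z - m'%:Z) + n%:Z * (k%:Z - k'%:Z - 1));
    last lia.
  rewrite [in RHS](_ : _ - _ =
    (n%:Z + m%:Z - m'%:Z) + n%:Z * (k'%:Z - k%:Z - 1)); last lia.
  by rewrite !zero//; lia.
- rewrite (_ : _ - _ = (m%:Z - m'%:Z) + n%:Z * (k%:Z - k'%:Z)); last lia.
  rewrite [in RHS](_ : _ - _ = (m%:Z - m'%:Z) + n%:Z * (k'%:Z - k%:Z));
    last lia.
  by rewrite !zero//; lia.
- rewrite (_ : _ - _ = n%:Z * (k%:Z - k'%:Z)); last lia.
  rewrite even; congr fourier; lia.
Qed.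

End complex_symmetry.

Theorem theorem3p1 (R : realType) (n : nat) (hn : (1 <= n)%N)
    (phi : R -> R[i]) (hphi : LT +oo%E phi) :
  complex_symmetric (Cn R hn) (toeplitz phi) <->
  (forall l : int, fourier phi (n%:Z * l) = fourier phi (- (n%:Z * l))) /\
  (forall l r : int, 1 <= r <= n%:Z - 1 -> fourier phi (r + n%:Z * l) = 0).
Proof.
exact: iff_trans (complex_symmetric_flip hn hphi) (flip_symmetricP hn hphi).
Qed.
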